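(* Let $X$ be a real vector space with two angularly equivalent norms $\|\cdot\|_1$ and $\|\cdot\|_2$. Then $(X,\|\cdot\|_1)$ is uniformly non-square if and only if $(X,\|\cdot\|_2)$ is uniformly non-square.
   Context: For a real normed space $(X,\|\cdot\|)$ and $x,y\in X$, define $g^{\pm}(x,y)=\|x\|\lim_{t\to 0^{\pm}}\frac1t(\|x+ty\|-\|x\|)$ (these one-sided limits always exist) and the $g$-functional $g(x,y)=\frac12(g^+(x,y)+g^-(x,y))$. For non-zero $x,y$ the norm angle from $x$ to $y$ is $\theta(x,y)\in[0,\pi]$ with $\cos\theta(x,y)=\frac{g(x,y)}{\|x\|\|y\|}$. Two norms $\|\cdot\|_1,\|\cdot\|_2$ on a real vector space $X$, with norm angles $\theta_1,\theta_2$, are angularly equivalent if there is a constant $C$ such that $\tan\left(\frac{\theta_2(x,y)}{2}\right)\le C\tan\left(\frac{\theta_1(x,y)}{2}\right)$ for all non-zero $x,y\in X$, where $\tan(\pi/2)$ is taken to be $+\infty$. (This is a symmetric relation.) A normed space $(X,\|\cdot\|)$ with unit sphere $S_X$ is uniformly non-square if there exists $\delta\in(0,1)$ such that: if $x,y\in S_X$ and $\left\|\frac{x-y}{2}\right\|\ge 1-\delta$, then $\left\|\frac{x+y}{2}\right\|\le 1-\delta$. *)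

(* Defs.v *)
From mathcomp Require Import all_boot all_order all_algebra.
From mathcomp Require Import all_classical all_reals all_analysis.

Set Implicit Arguments.
Unset Strict Implicit.
Unset Printing Implicit Defensive.

Import Order.TTheory GRing.Theory Num.Theory.
Import numFieldNormedType.Exports.

Local Open Scope classical_set_scope.
Local Open Scope ring_scope.

(* Norms are explicit functions on a bare left module, rather than a
   [normedModType] structure, so that one vector space can carry two of them.
   The fields are those of the factory [Lmodule_isNormed]; nonnegativity and
   [N 0 = 0] follow from them. *)
Record is_norm (R : realType) (X : lmodType R) (N : X -> R) : Prop := IsNorm {
  norm_triangle : forall x y : X, N (x + y) <= N x + N y;
  norm_homogeneous : forall (a : R) (x : X), N (a *: x) = `|a| * N x;
  norm_definite : forall x : X, N x = 0 -> x = 0 }.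

(* For a norm the difference quotient is monotone in [t] and bounded by [N y],
   so both one-sided limits exist and [lim] is not a default value. *)
Definition g_right (R : realType) (X : lmodType R) (N : X -> R) (x y : X) : R :=
  N x * lim (t^-1 * (N (x + t *: y) - N x) @[t --> (0 : R)^'+]).

Definition g_left (R : realType) (X : lmodType R) (N : X -> R) (x y : X) : R :=
  N x * lim (t^-1 * (N (x + t *: y) - N x) @[t --> (0 : R)^'-]).

Definition g_functional (R : realType) (X : lmodType R) (N : X -> R)
    (x y : X) : R :=
  2^-1 * (g_right N x y + g_left N x y).

(* [|g_functional N x y| <= N x * N y], so for non-zero [x] and [y] this is the
   unique angle in [0, pi] with the prescribed cosine. *)
Definition norm_angle (R : realType) (X : lmodType R) (N : X -> R)
    (x y : X) : R :=
  acos (g_functional N x y / (N x * N y)).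

(* The library's [tan] takes the junk value 0 at [pi / 2]. *)
Definition etan (R : realType) (a : R) : \bar R :=
  if a == pi / 2 then +oo%E else (tan a)%:E.

(* The sign of [C] is not prescribed: [y = - x] makes both angles [pi], so the
   inequality there reads [+oo <= C * +oo], which (with [0 * +oo = 0]) forces
   [0 < C] as soon as [X] is non-trivial. *)
Definition angularly_equivalent (R : realType) (X : lmodType R)
    (N1 N2 : X -> R) : Prop :=
  exists C : R, forall x y : X, x != 0 -> y != 0 ->
    (etan (norm_angle N2 x y / 2) <= C%:E * etan (norm_angle N1 x y / 2))%E.

Definition uniformly_non_square (R : realType) (X : lmodType R)
    (N : X -> R) : Prop :=
  exists delta : R, 0 < delta < 1 /\
    forall x y : X, N x = 1 -> N y = 1 ->
      1 - delta <= N (2^-1 *: (x - y)) -> N (2^-1 *: (x + y)) <= 1 - delta.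

(* Main.v *)
(* Write [c] for the cosine of the norm angle, so that [tan (theta / 2) ^ 2] is
   [(1 - c) / (1 + c)]. Angular equivalence makes [1 - c1] and [1 - c2]
   comparable wherever the angles are acute. Since
   [g (x, x + y) = N x ^ 2 + g (x, y)], we have
   [N (x + y) = c (x + y, x) N x + c (x + y, y) N y]: for unit vectors,
   [N1 (x + y)] is close to [2] exactly when both cosines are close to [1], and
   then [N2 (x + y)] is close to [N2 x + N2 y]. The same holds with [- y], so
   [x / N2 x] and [y / N2 y] violate non-squareness of [N2], provided
   [N2 x / N2 y] is bounded; that bound again comes from comparing angles. *)

Require Import Defs.
From mathcomp Require Import all_boot all_order all_algebra.
From mathcomp Require Import all_classical all_reals all_analysis.
From mathcomp Require Import ring lra.

Set Implicit Arguments.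
Unset Strict Implicit.
Unset Printing Implicit Defensive.

Import Order.TTheory GRing.Theory Num.Theory.
Import numFieldNormedType.Exports.

Local Open Scope classical_set_scope.
Local Open Scope ring_scope.

(** * Elementary consequences of the norm axioms *)

Lemma is_normN (R : realType) (X : lmodType R) (N : X -> R) (x : X) :
  is_norm N -> N (- x) = N x.
Proof.
by move=> hN; rewrite -scaleN1r (norm_homogeneous hN) normrN1 mul1r.
Qed.

Lemma is_norm0 (R : realType) (X : lmodType R) (N : X -> R) :
  is_norm N -> N 0 = 0.
Proof.
by move=> hN; rewrite -(scale0r 0) (norm_homogeneous hN) normr0 mul0r.
Qed.

Lemma is_norm_ge0 (R : realType) (X : lmodType R) (N : X -> R) (x : X) :
  is_norm N -> 0 <= N x.
Proof.
move=> hN; have := norm_triangle hN x (- x).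
by rewrite subrr is_norm0// is_normN//; lra.
Qed.

Lemma is_norm_gt0 (R : realType) (X : lmodType R) (N : X -> R) (x : X) :
  is_norm N -> (0 < N x) = (x != 0).
Proof.
move=> hN; rewrite lt_def is_norm_ge0// andbT; congr (~~ _).
by apply/eqP/eqP => [/(norm_definite hN)//|->]; exact: is_norm0.
Qed.

Lemma is_norm_lipschitz (R : realType) (X : lmodType R) (N : X -> R) (x y : X) :
  is_norm N -> `|N x - N y| <= N (x - y).
Proof.
move=> hN; have := norm_triangle hN (x - y) y.
have := norm_triangle hN (y - x) x.
by rewrite !subrK -(opprB x y) is_normN// ler_norml => *; lra.
Qed.

(** * Difference quotients, one-sided limits and the g-functional *)

Lemma quotient_norm_le (R : realType) (X : lmodType R) (N : X -> R) (x y : X)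
    (t : R) :
  is_norm N -> `|t^-1 * (N (x + t *: y) - N x)| <= N y.
Proof.
move=> hN; have [->|t0] := eqVneq t 0.
  by rewrite invr0 mul0r normr0 is_norm_ge0.
rewrite normrM normfV ler_pdivrMl ?normr_gt0// -(norm_homogeneous hN).
by rewrite (le_trans (is_norm_lipschitz _ _ hN))// addrC addKr.
Qed.

(** Convexity of [N]: the point [x + s *: y] is the convex combination of [x] and [x + t *: y] with
    weight [s / t]. *)
Lemma quotient_nondecreasing (R : realType) (X : lmodType R) (N : X -> R)
    (x y : X) (s t : R) :
  is_norm N -> 0 < s -> s <= t ->
  s^-1 * (N (x + s *: y) - N x) <= t^-1 * (N (x + t *: y) - N x).
Proof.
move=> hN s0 st; have t0 : 0 < t by lra.
have st1 : s / t <= 1 by rewrite ler_pdivrMr// mul1r.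
have st0 : 0 <= s / t by rewrite divr_ge0// ltW.
have -> : x + s *: y = (1 - s / t) *: x + (s / t) *: (x + t *: y).
  by rewrite scalerDr addrA -scalerDl subrK scale1r scalerA divfK ?gt_eqF.
rewrite ler_pdivrMl//.
have := norm_triangle hN ((1 - s / t) *: x) ((s / t) *: (x + t *: y)).
rewrite !(norm_homogeneous hN) !ger0_norm ?subr_ge0// mulrA.
by move: (N _) => A; lra.
Qed.

Lemma quotient_cvg_right (R : realType) (X : lmodType R) (N : X -> R)
    (x y : X) :
  is_norm N -> cvg (t^-1 * (N (x + t *: y) - N x) @[t --> (0 : R)^'+]).
Proof.
move=> hN; apply: nondecreasing_at_right_is_cvgr; near=> e.
  move=> s t; rewrite !in_itv/= => /andP[s0 _] _ st.
  exact: quotient_nondecreasing.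
exists (- N y) => _ [t _ <-].
by have := quotient_norm_le x y t hN; rewrite ler_norml => /andP[].
Unshelve. all: by end_near. Qed.

(** Reflecting [t] exchanges the two one-sided limits, at the price of a sign and of [- y] for [y];
    this reduces [g_left] to [g_right]. *)
Lemma quotient_oppr (R : realType) (X : lmodType R) (N : X -> R) (x y : X) :
  (fun t : R => t^-1 * (N (x + t *: y) - N x)) \o -%R =
  - (fun t : R => t^-1 * (N (x + t *: - y) - N x)).
Proof. by apply/funext => t /=; rewrite invrN mulNr scaleNr -scalerN. Qed.

Lemma quotient_cvg_left (R : realType) (X : lmodType R) (N : X -> R)
    (x y : X) : is_norm N ->
  t^-1 * (N (x + t *: y) - N x) @[t --> (0 : R)^'-] -->
  - lim (t^-1 * (N (x + t *: - y) - N x) @[t --> (0 : R)^'+]).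
Proof.
move=> hN; apply/cvg_at_leftNP; rewrite oppr0 quotient_oppr.
by apply: cvgN; exact: quotient_cvg_right.
Qed.

Lemma g_leftE (R : realType) (X : lmodType R) (N : X -> R) (x y : X) :
  is_norm N -> g_left N x y = - g_right N x (- y).
Proof.
move=> hN; rewrite /g_left /g_right -mulrN; congr (_ * _).
by apply: cvg_lim => //; exact: quotient_cvg_left.
Qed.

Lemma g_functionalE (R : realType) (X : lmodType R) (N : X -> R) (x y : X) :
  is_norm N -> g_functional N x y = 2^-1 * (g_right N x y - g_right N x (- y)).
Proof. by move=> hN; rewrite /g_functional g_leftE. Qed.

Lemma g_functionalN (R : realType) (X : lmodType R) (N : X -> R) (x y : X) :
  is_norm N -> g_functional N x (- y) = - g_functional N x y.
Proof. by move=> hN; rewrite !g_functionalE// opprK; ring. Qed.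

Lemma g_right_norm_le (R : realType) (X : lmodType R) (N : X -> R) (x y : X) :
  is_norm N -> `|g_right N x y| <= N x * N y.
Proof.
move=> hN; rewrite normrM ger0_norm ?is_norm_ge0// ler_wpM2l ?is_norm_ge0//.
rewrite ler_norml; apply/andP; split.
  apply: limr_ge; first exact: quotient_cvg_right.
  near=> t.
  by have := quotient_norm_le x y t hN; rewrite ler_norml => /andP[].
apply: limr_le; first exact: quotient_cvg_right.
near=> t.
by have := quotient_norm_le x y t hN; rewrite ler_norml => /andP[].
Unshelve. all: by end_near. Qed.

Lemma g_functional_norm_le (R : realType) (X : lmodType R) (N : X -> R)
    (x y : X) : is_norm N -> `|g_functional N x y| <= N x * N y.
Proof.
move=> hN; rewrite g_functionalE//.
have := g_right_norm_le x y hN; have := g_right_norm_le x (- y) hN.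
by rewrite (is_normN y hN) !ler_norml => *; lra.
Qed.

(* [(1 + t) (x + t y) = (x + t (x + y)) + t^2 y], so the two difference
   quotients differ by [N x] up to an error linear in [t]. *)
Lemma quotient_translate (R : realType) (X : lmodType R) (N : X -> R)
    (x y : X) (t : R) : is_norm N -> -1 < t -> t != 0 ->
  `|t^-1 * (N (x + t *: (x + y)) - N x) -
    (N x + t^-1 * (N (x + t *: y) - N x))| <= 2 * N y * `|t|.
Proof.
move=> hN t1 t0; set A := N (x + t *: (x + y)); set B := N (x + t *: y).
have hA : `|A - (1 + t) * B| <= `|t| ^+ 2 * N y.
  have -> : (1 + t) * B = N ((1 + t) *: (x + t *: y)).
    by rewrite (norm_homogeneous hN) gtr0_norm//; lra.
  rewrite (le_trans (is_norm_lipschitz _ _ hN))//.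
  have -> : (1 + t) *: (x + t *: y) = x + t *: (x + y) + t ^+ 2 *: y.
    by rewrite scalerDl scale1r !scalerDr scalerA -expr2 addrACA !addrA.
  by rewrite opprD addrA subrr add0r is_normN// (norm_homogeneous hN) normrX.
have hB : `|t * (B - N x)| <= `|t| ^+ 2 * N y.
  rewrite normrM expr2 -mulrA ler_wpM2l//.
  rewrite -(norm_homogeneous hN) (le_trans (is_norm_lipschitz _ _ hN))//.
  by rewrite addrC addKr.
have -> : t^-1 * (A - N x) - (N x + t^-1 * (B - N x)) =
    t^-1 * ((A - (1 + t) * B) + t * (B - N x)) by field.
rewrite normrM normfV ler_pdivrMl ?normr_gt0//.
by rewrite (le_trans (ler_normD _ _))//; lra.
Qed.

Lemma g_right_translate (R : realType) (X : lmodType R) (N : X -> R)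
    (x y : X) : is_norm N -> g_right N x (x + y) = N x ^+ 2 + g_right N x y.
Proof.
move=> hN; rewrite /g_right expr2 -mulrDr; congr (_ * _).
apply: cvg_lim => //.
rewrite -[X in _ --> X]addr0.
set q := fun t : R => t^-1 * (N (x + t *: y) - N x).
set p := fun t : R => t^-1 * (N (x + t *: (x + y)) - N x).
have -> : p = (fun t => (N x + q t) + (p t - (N x + q t))).
  by apply/funext => t; rewrite addrC subrK.
apply: cvgD; first by apply: cvgD; [exact: cvg_cst|exact: quotient_cvg_right].
apply/norm_cvg0P.
apply: (@squeeze_cvgr _ _ _ _ (fun=> 0) (fun t => 2 * N y * `|t|)).
- near=> t; rewrite normr_ge0/=; have t0 : 0 < t by [].
  by apply: quotient_translate => //; lra.
- exact: cvg_cst.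
- have : 2 * N y * `|t| @[t --> (0 : R)^'+] --> 2 * N y * `|0 : R|.
    apply: cvgM; first exact: cvg_cst.
    by apply: cvg_norm; apply: cvg_at_right_filter; exact: cvg_id.
  by rewrite normr0 mulr0.
Unshelve. all: by end_near. Qed.

Lemma g_functional_translate (R : realType) (X : lmodType R) (N : X -> R)
    (x y : X) : is_norm N ->
  g_functional N x (x + y) = N x ^+ 2 + g_functional N x y.
Proof.
move=> hN; rewrite !g_functionalE// g_right_translate//.
(* Read backwards: translating [- (x + y)] by [x] gives [- y], which handles the left derivative. *)
have := g_right_translate x (- (x + y)) hN.
by rewrite opprD addNKr => ->; field.
Qed.

(** * Cosine of the norm angle *)

Definition norm_cos (R : realType) (X : lmodType R) (N : X -> R)
    (x y : X) : R :=
  g_functional N x y / (N x * N y).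

Lemma norm_cosN (R : realType) (X : lmodType R) (N : X -> R) (x y : X) :
  is_norm N -> norm_cos N x (- y) = - norm_cos N x y.
Proof. by move=> hN; rewrite /norm_cos g_functionalN// is_normN// mulNr. Qed.

Lemma norm_cos_itv (R : realType) (X : lmodType R) (N : X -> R) (x y : X) :
  is_norm N -> x != 0 -> y != 0 -> -1 <= norm_cos N x y <= 1.
Proof.
move=> hN x0 y0; have xy0 : 0 < N x * N y by rewrite mulr_gt0 ?is_norm_gt0.
by rewrite -ler_norml normrM normfV (gtr0_norm xy0) ler_pdivrMr// mul1r
  g_functional_norm_le.
Qed.

Lemma norm_cosM (R : realType) (X : lmodType R) (N : X -> R) (x y : X) :
  is_norm N -> x != 0 -> y != 0 ->
  norm_cos N x y * N y = g_functional N x y / N x.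
Proof.
move=> hN; rewrite -!(is_norm_gt0 _ hN) => x0 y0.
by rewrite /norm_cos; field; lra.
Qed.

(** Translation is applied to both [y] and [- y], whose g-terms cancel. *)
Lemma norm_cosDB (R : realType) (X : lmodType R) (N : X -> R) (x y : X) :
  is_norm N -> x != 0 -> x + y != 0 -> x - y != 0 ->
  norm_cos N x (x + y) * N (x + y) + norm_cos N x (x - y) * N (x - y) = 2 * N x.
Proof.
move=> hN x0 xy0 yx0; rewrite !norm_cosM// !g_functional_translate//.
by rewrite g_functionalN//; field; rewrite gt_eqF ?is_norm_gt0.
Qed.

(* For [y] small compared with [x], the direction of [x + y] is close to that
   of [x]. *)
Lemma norm_cosD_ge (R : realType) (X : lmodType R) (N : X -> R) (x y : X) :
  is_norm N -> x != 0 -> x + y != 0 ->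
  (1 - norm_cos N x (x + y)) * N (x + y) <= 2 * N y.
Proof.
move=> hN x0 xy0; rewrite mulrBl norm_cosM// g_functional_translate// mul1r.
have Nx0 : 0 < N x by rewrite is_norm_gt0.
have := g_functional_norm_le x y hN; rewrite ler_norml => /andP[g _].
have : - N y <= g_functional N x y / N x by rewrite ler_pdivlMr// mulrC; lra.
have := norm_triangle hN x y.
rewrite mulrDl expr2 mulfK ?gt_eqF//; lra.
Qed.

(** * From half-angle tangents to cosines *)

Lemma cos_half_acos (R : realType) (c : R) :
  -1 <= c <= 1 -> 2 * cos (acos c / 2) ^+ 2 = 1 + c.
Proof.
move=> c1; have := cos_mulr2n (acos c / 2).
rewrite -[acos c / 2 *+ 2]mulr_natr divfK// acosK ?in_itv// => ce.
lra.
Qed.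

(** This is the squared tangent inequality with denominators cleared, via [1 - c = 2 sin ^ 2] and
    [1 + c = 2 cos ^ 2] at the half angle. *)
Lemma etan_half_acos_le (R : realType) (C c1 c2 : R) :
  -1 <= c1 <= 1 -> -1 <= c2 <= 1 ->
  (etan (acos c2 / 2) <= C%:E * etan (acos c1 / 2))%E ->
  (1 - c2) * (1 + c1) <= C ^+ 2 * ((1 - c1) * (1 + c2)).
Proof.
move=> h1 h2.
have cosE (c : R) (h : -1 <= c <= 1) : 1 - c = 2 * sin (acos c / 2) ^+ 2.
  by rewrite sin2cos2 mulrBr cos_half_acos//; ring.
have half_itv (c : R) (h : -1 <= c <= 1) : 0 <= acos c / 2 <= pi / 2.
  by rewrite divr_ge0 ?acos_ge0// ler_pM2r ?invr_gt0// acos_lepi.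
have half_sin (c : R) (h : -1 <= c <= 1) : 0 <= sin (acos c / 2).
  apply: sin_ge0_pi; have := half_itv c h; have := pi_gt0 R; lra.
have half_cos (c : R) (h : -1 <= c <= 1) :
    acos c / 2 != pi / 2 -> 0 < cos (acos c / 2).
  move=> hc; apply: cos_gt0_pihalf; have := half_itv c h; have := pi_gt0 R.
  by move: hc; rewrite neq_lt => /orP[]; lra.
have [c1N|c1N] := eqVneq c1 (-1).
  rewrite c1N subrr mulr0 => _.
  by rewrite mulr_ge0 ?sqr_ge0// mulr_ge0//; lra.
have ne1 : acos c1 / 2 != pi / 2.
  apply: contra c1N => /eqP e1; have := cos_half_acos h1.
  by rewrite e1 cos_pihalf => e; apply/eqP; lra.
(* The first case would put [+oo] below a finite number. *)
rewrite /etan (negbTE ne1); case: ifPn => [//|ne2].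
rewrite -EFinM lee_fin => ht.
have k1 := half_cos _ h1 ne1; have k2 := half_cos _ h2 ne2.
have s1 := half_sin _ h1; have s2 := half_sin _ h2.
have := cosE _ h1; have := cosE _ h2.
rewrite -(cos_half_acos h1) -(cos_half_acos h2) => -> ->.
move: ht; rewrite /tan ler_pdivrMr// mulrA mulrAC ler_pdivlMr// => ht.
have : (sin (acos c2 / 2) * cos (acos c1 / 2)) ^+ 2 <=
       (C * sin (acos c1 / 2) * cos (acos c2 / 2)) ^+ 2.
  (* The sign of [C] is unknown, so the right side is nonnegative only because [ht] puts it above
     the left one. *)
  by rewrite lerXn2r// nnegrE ?(le_trans _ ht)// mulr_ge0// ltW.
rewrite !exprMn; lra.
Qed.

Lemma norm_cos_sum (R : realType) (X : lmodType R) (N : X -> R) (x y : X) :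
  is_norm N -> x != 0 -> y != 0 -> x + y != 0 ->
  norm_cos N (x + y) x * N x + norm_cos N (x + y) y * N y = N (x + y).
Proof.
move=> hN x0 y0 xy0; rewrite !norm_cosM//.
have := g_functional_translate (x + y) (- y) hN.
rewrite addrK g_functionalN// => ->.
by field; rewrite gt_eqF ?is_norm_gt0.
Qed.

(** Since [1 - cos] is twice the squared sine of the half angle, this compares small angles without
    trigonometry. *)
Definition angle_dominated (R : realType) (X : lmodType R) (L : R)
    (N1 N2 : X -> R) : Prop :=
  forall x y : X, x != 0 -> y != 0 -> 0 <= norm_cos N1 x y ->
    1 - norm_cos N2 x y <= L * (1 - norm_cos N1 x y).

Lemma angularly_equivalent_dominated (R : realType) (X : lmodType R)
    (N1 N2 : X -> R) :
  is_norm N1 -> is_norm N2 -> angularly_equivalent N1 N2 ->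
  exists L : R,
    [/\ 1 <= L, angle_dominated L N1 N2 & angle_dominated L N2 N1].
Proof.
move=> hN1 hN2 [C hC].
(* [norm_angle] is by definition [acos] of [norm_cos], so [hC] fits as it stands. *)
have key x y (x0 : x != 0) (y0 : y != 0) :=
  etan_half_acos_le (norm_cos_itv hN1 x0 y0) (norm_cos_itv hN2 x0 y0)
    (hC x y x0 y0).
(* For [c >= 0], [1 - d <= (1 - d) * (1 + c) <= C ^+ 2 * (1 - c) * (1 + d)], and [1 + d <= 2]; the
   added 1 secures [1 <= L]. *)
exists (2 * C ^+ 2 + 1); have C2 : 0 <= C ^+ 2 := sqr_ge0 C; split; first lra.
- move=> x y x0 y0 c1; have := key x y x0 y0.
  have := norm_cos_itv hN1 x0 y0; have := norm_cos_itv hN2 x0 y0.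
  move: C2; move: (C ^+ 2) (norm_cos _ _ _) (norm_cos N1 _ _) c1 => K d c *.
  have : 0 <= K * ((1 - c) * (1 - d)) by rewrite !mulr_ge0//; lra.
  have : 0 <= c * (1 - d) by rewrite mulr_ge0//; lra.
  lra.
(* Passing to [- y] negates both cosines, which turns tangents into cotangents and so reverses the
   comparison. *)
- move=> x y x0 y0 c2; have yN0 : - y != 0 by rewrite oppr_eq0.
  have := key x (- y) x0 yN0; rewrite !norm_cosN//.
  have := norm_cos_itv hN1 x0 y0; have := norm_cos_itv hN2 x0 y0.
  move: C2; move: (C ^+ 2) (norm_cos N1 _ _) (norm_cos N2 _ _) c2 => K c d *.
  have : 0 <= K * ((1 - c) * (1 - d)) by rewrite !mulr_ge0//; lra.
  have : 0 <= d * (1 - c) by rewrite mulr_ge0//; lra.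
  lra.
Qed.

(* If [N2 x] were much larger than [N2 y], then the [N2]-angles, hence the
   [N1]-angles, from [x] to [x + 4 y] and to [x - 4 y] would be small, so that
   [2 N1 x] would be nearly [N1 (x + 4 y) + N1 (x - 4 y) >= 8 N1 y]. *)
Lemma angle_dominated_ratio (R : realType) (X : lmodType R) (N1 N2 : X -> R)
    (L : R) (x y : X) :
  is_norm N1 -> is_norm N2 -> 1 <= L -> angle_dominated L N2 N1 ->
  x != 0 -> N1 x = N1 y -> N2 x <= 16 * L * N2 y.
Proof.
move=> hN1 hN2 L1 h21 x0 xy; rewrite leNgt; apply/negP => hx.
have y0 : y != 0 by rewrite -(is_norm_gt0 _ hN1) -xy is_norm_gt0.
have n1 : 0 < N1 y by rewrite is_norm_gt0.
have n2 : 0 < N2 y by rewrite is_norm_gt0.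
have Ln : N2 y <= L * N2 y by rewrite ler_peMl// ltW.
have far z : N2 z = 4 * N2 y -> 12 * (L * N2 y) <= N2 (x + z).
  move=> hz; have := norm_triangle hN2 (x + z) (- z).
  by rewrite addrK is_normN//; lra.
have far0 z : N2 z = 4 * N2 y -> x + z != 0.
  by move=> hz; rewrite -(is_norm_gt0 _ hN2); have := far z hz; lra.
(* The bounds give [L * (1 - d) <= 8 / 12], hence [d >= 0] and [c >= 1 / 3]. This suffices at the
   end, as [8 / 3 > 2]. *)
have cos_ge z : N2 z = 4 * N2 y -> 3^-1 <= norm_cos N1 x (x + z).
  move=> hz; have := norm_cosD_ge hN2 x0 (far0 z hz).
  have := h21 x (x + z) x0 (far0 z hz).
  have /andP[_] := norm_cos_itv hN2 x0 (far0 z hz).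
  move: (norm_cos N1 _ _) (norm_cos N2 _ _) => c d d1 hcd.
  have := far z hz; rewrite hz => hf hd.
  have : (1 - d) * (12 * (L * N2 y)) <= 8 * N2 y.
    by rewrite (le_trans _ (le_trans hd _)) ?ler_wpM2l//; lra.
  have -> : (1 - d) * (12 * (L * N2 y)) = 12 * (L * (1 - d)) * N2 y by ring.
  rewrite ler_pM2r// => hLd.
  have : (1 - d) <= L * (1 - d) by rewrite ler_peMl//; lra.
  have := hcd; lra.
have N4 : N2 (4 *: y) = 4 * N2 y.
  by rewrite (norm_homogeneous hN2) ger0_norm.
have N4N : N2 (- (4 *: y)) = 4 * N2 y by rewrite is_normN.
have := norm_cosDB hN1 x0 (far0 _ N4) (far0 _ N4N).
have := cos_ge _ N4; have := cos_ge _ N4N; rewrite xy.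
have := norm_triangle hN1 (x + 4 *: y) (- (x - 4 *: y)).
have -> : x + 4 *: y - (x - 4 *: y) = 8 *: y.
  by rewrite opprB addrC subrKA -scalerDl; congr (_ *: _); ring.
rewrite is_normN// (norm_homogeneous hN1) ger0_norm//.
have := is_norm_ge0 (x + 4 *: y) hN1; have := is_norm_ge0 (x - 4 *: y) hN1.
set p := N1 (x + 4 *: y); set q := N1 (x - 4 *: y).
set c := norm_cos N1 x (x - 4 *: y); set d := norm_cos N1 x (x + 4 *: y).
move=> q0 p0 hpq hc hd.
have : 3^-1 * q <= c * q by rewrite ler_wpM2r.
have : 3^-1 * p <= d * p by rewrite ler_wpM2r.
lra.
Qed.

(** * Transfer of nearly square pairs between the norms *)

(** Two cosines, each at most 1, add up to at least [2 - 2 * e], so each is at least [1 - 2 * e].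
    The bound on [e] keeps them nonnegative, as domination requires. *)
Lemma angle_dominated_norm_sum (R : realType) (X : lmodType R)
    (N1 N2 : X -> R) (L e : R) (x y : X) :
  is_norm N1 -> is_norm N2 -> 0 <= L -> angle_dominated L N1 N2 ->
  2 * e <= 1 -> N1 x = 1 -> N1 y = 1 -> 2 - 2 * e <= N1 (x + y) ->
  (1 - 2 * e * L) * (N2 x + N2 y) <= N2 (x + y).
Proof.
move=> hN1 hN2 L0 h12 he x1 y1 hxy.
have x0 : x != 0 by rewrite -(is_norm_gt0 _ hN1) x1.
have y0 : y != 0 by rewrite -(is_norm_gt0 _ hN1) y1.
have u0 : x + y != 0 by rewrite -(is_norm_gt0 _ hN1); lra.
have := norm_cos_sum hN1 x0 y0 u0; rewrite x1 y1 !mulr1 => hsum.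
have /andP[_ cx1] := norm_cos_itv hN1 u0 x0.
have /andP[_ cy1] := norm_cos_itv hN1 u0 y0.
have cos_ge z : z != 0 -> 1 - 2 * e <= norm_cos N1 (x + y) z ->
    1 - 2 * e * L <= norm_cos N2 (x + y) z.
  move=> z0 hz; have c0 : 0 <= norm_cos N1 (x + y) z by lra.
  have := h12 _ _ u0 z0 c0.
  have : L * (1 - norm_cos N1 (x + y) z) <= L * (2 * e).
    by rewrite ler_wpM2l//; lra.
  lra.
rewrite -(norm_cos_sum hN2 x0 y0 u0) mulrDr.
by apply: lerD; rewrite ler_wpM2r ?is_norm_ge0// cos_ge//; lra.
Qed.

(** With [N x <= N y], write [x + y] as [N x] times the normalized sum plus [(1 - N x / N y) *: y].
    The triangle inequality then bounds the normalized sum below, and dividing by [N x] costs the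
    ratio [M]. *)
Lemma norm_normalized_sum (R : realType) (X : lmodType R) (N : X -> R)
    (k M : R) (x y : X) :
  is_norm N -> 0 <= k -> x != 0 -> y != 0 ->
  N x <= M * N y -> N y <= M * N x ->
  (1 - k) * (N x + N y) <= N (x + y) ->
  2 - k * (1 + M) <= N ((N x)^-1 *: x + (N y)^-1 *: y).
Proof.
move=> hN k0; wlog xy : x y / N x <= N y => [hwlog x0 y0 hx hy hxy|].
  have [|/ltW] := leP (N x) (N y) => le_xy; first exact: hwlog.
  rewrite [_ *: x + _]addrC; apply: hwlog => //.
  by rewrite [N y + _]addrC [y + x]addrC.
rewrite -!(is_norm_gt0 _ hN) => x0 y0 _ hy hxy.
set T := N (_ + _).
have : N (x + y) <= N x * T + (N y - N x).
  have -> : x + y = N x *: ((N x)^-1 *: x + (N y)^-1 *: y)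
      + (1 - N x / N y) *: y.
    rewrite scalerDr !scalerA divff ?gt_eqF// scale1r -addrA -scalerDl.
    by rewrite [_ / _ + _]addrC subrK scale1r.
  rewrite (le_trans (norm_triangle hN _ _))// !(norm_homogeneous hN).
  rewrite (gtr0_norm x0) lerD2l ger0_norm ?subr_ge0 ?ler_pdivrMr ?mul1r//.
  by rewrite mulrBl mul1r divfK// gt_eqF.
have : k * N y <= k * (M * N x) by rewrite ler_wpM2l.
by move=> *; rewrite -(ler_pM2l x0); lra.
Qed.

Lemma angle_dominated_non_square (R : realType) (X : lmodType R)
    (N1 N2 : X -> R) (L : R) :
  is_norm N1 -> is_norm N2 -> 1 <= L ->
  angle_dominated L N1 N2 -> angle_dominated L N2 N1 ->
  uniformly_non_square N2 -> uniformly_non_square N1.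
Proof.
move=> hN1 hN2 L1 h12 h21 [d [/andP[d0 d1] hd]].
have half (N : X -> R) z : is_norm N -> N (2^-1 *: z) = 2^-1 * N z.
  by move=> hN; rewrite (norm_homogeneous hN) ger0_norm.
have L0 : 0 <= L by lra.
(* [M] bounds the [N2]-ratio of [N1]-unit vectors; [D] makes the total loss [2 * e * L * (1 + M)]
   equal to [d / 2]. *)
pose M := 16 * L; pose D := 4 * L * (1 + M); pose e := d / D.
have D4 : 4 <= D.
  have : 1 * 1 <= L * (1 + M) by rewrite ler_pM// /M; lra.
  by rewrite /D; lra.
have e0 : 0 < e by rewrite divr_gt0//; lra.
have e4 : 4 * e <= 1 by rewrite /e mulrA ler_pdivrMr; lra.
have eD : e * D = d by rewrite /e divfK// gt_eqF//; lra.
exists e; split=> [|x y x1 y1]; first by apply/andP; split; lra.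
rewrite !half// => hm; rewrite leNgt; apply/negP => hp.
have x0 : x != 0 by rewrite -(is_norm_gt0 _ hN1) x1.
have y0 : y != 0 by rewrite -(is_norm_gt0 _ hN1) y1.
have hxy : N2 x <= M * N2 y.
  by apply: (angle_dominated_ratio hN1 hN2) => //; rewrite x1.
have hyx : N2 y <= M * N2 x.
  by apply: (angle_dominated_ratio hN1 hN2) => //; rewrite x1.
(* Used for [z = y] and [z = - y]. The bound [2 - d] exceeds [2 - 2 * d] strictly, which contradicts
   the non-strict conclusion of [hd]. *)
have unit_sum z : z != 0 -> N1 z = 1 -> N2 z = N2 y ->
    2 - 2 * e <= N1 (x + z) ->
    2 - 2 * d <= N2 ((N2 x)^-1 *: x + (N2 z)^-1 *: z) - d.
  move=> z0 z1 zy hz.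
  have := @norm_normalized_sum _ _ N2 (2 * e * L) M x z hN2.
  rewrite !zy => /(_ _ x0 z0 hxy hyx).
  have eL : 0 <= 2 * e * L by apply: mulr_ge0; lra.
  have hs := angle_dominated_norm_sum hN1 hN2 L0 h12.
  rewrite -zy => /(_ eL (hs _ _ _ _ x1 z1 hz)).
  have : 2 * (2 * e * L * (1 + M)) = d by rewrite -eD /D; ring.
  lra.
have normalize1 z : z != 0 -> N2 ((N2 z)^-1 *: z) = 1.
  rewrite -(is_norm_gt0 _ hN2) => z0.
  by rewrite (norm_homogeneous hN2) ger0_norm ?invr_ge0 ?ltW// mulVf// gt_eqF.
have := hd _ _ (normalize1 _ x0) (normalize1 _ y0); rewrite !half//.
have := unit_sum y y0 y1 erefl; have := unit_sum (- y).
rewrite oppr_eq0 (is_normN y hN1) !(is_normN y hN2) scalerN.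
move=> /(_ y0 y1 erefl) hm' hp' hd'.
have {}hm' := hm' _; have {}hp' := hp' _.
lra.
Qed.

Theorem theorem14 (R : realType) (X : lmodType R) (N1 N2 : X -> R)
    (hN1 : is_norm N1) (hN2 : is_norm N2)
    (hN12 : angularly_equivalent N1 N2) :
  uniformly_non_square N1 <-> uniformly_non_square N2.
Proof.
have [L [L1 h12 h21]] := angularly_equivalent_dominated hN1 hN2 hN12.
by split; apply: (angle_dominated_non_square (L := L)).
Qed.
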